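(* Let $E\subset[0,1]$ be a Borel set with $\dim_{\mathbb F}(E)>\frac12$. Then there exist positive integers $a,b,c,d$ with $a+b=c+d$ such that $E$ contains a nontrivial solution of the equation $ax_1+bx_2=cy_1+dy_2$; that is, there is $(x_1,x_2,y_1,y_2)\in E^4$ with $ax_1+bx_2=cy_1+dy_2$ which is not a trivial solution.
   Context: Fourier dimension: for a Borel set $E\subset\mathbb R$, $\dim_{\mathbb F}(E)$ is the supremum of all $\beta\in[0,1]$ for which there exist a Borel probability measure $\mu$ supported on $E$ and a constant $C\in(0,\infty)$ such that $|\hat\mu(\xi)|\le C(1+|\xi|)^{-\beta/2}$ for all $\xi\in\mathbb R$, where $\hat\mu(\xi)=\int e^{-2\pi i x\xi}\,d\mu(x)$. Genus: let $a,b,c,d$ be positive integers with $a+b=c+d$. The equation $ax_1+bx_2=cy_1+dy_2$, written $ax_1+bx_2+(-c)y_1+(-d)y_2=0$, is of genus one if no nonempty proper subcollection of the four coefficients $a,b,-c,-d$ (counted with multiplicity) sums to $0$; otherwise it is of genus two, in which case $\{a,b\}=\{c,d\}$ as multisets. Trivial solutions: for an equation of genus one, a solution is trivial if $x_1=x_2=y_1=y_2$. For an equation of genus two, a solution is trivial if the variables on the two sides are equal in pairs with equal coefficients, i.e. if ($a=c$, $b=d$, $x_1=y_1$ and $x_2=y_2$) or ($a=d$, $b=c$, $x_1=y_2$ and $x_2=y_1$). All other solutions are nontrivial. *)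

(* Defs.v *)
From HB Require Import structures.
From mathcomp Require Import all_boot all_order all_algebra.
From mathcomp Require Import all_classical all_reals all_analysis.
From mathcomp Require Import complex.

Set Implicit Arguments.
Unset Strict Implicit.
Unset Printing Implicit Defensive.

Import Order.TTheory GRing.Theory Num.Theory.
Import numFieldNormedType.Exports.

Local Open Scope classical_set_scope.
Local Open Scope ring_scope.
Local Open Scope complex_scope.

Definition cis (R : realType) (t : R) : R[i] := cos t +i* sin t.

Definition Cintegral d (T : measurableType d) (R : realType)
    (mu : {measure set T -> \bar R}) (D : set T) (f : T -> R[i]) : R[i] :=
  Rintegral mu D (fun x => complex.Re (f x)) +i*
  Rintegral mu D (fun x => complex.Im (f x)).

Definition fourier_transform (R : realType)
    (mu : probability (measurableTypeR R) R) (xi : R) : R[i] :=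
  Cintegral mu setT (fun x : R => cis (- (2 * pi * x * xi))).

(* For a Borel set E, "supported on E" means that mu gives E full measure;
   the topological support of mu need not be contained in E.
   The order of R[i] is partial: the inequality below compares two elements
   with zero imaginary part. *)
Definition has_fourier_decay (R : realType) (E : set (measurableTypeR R))
    (beta : R) : Prop :=
  exists (mu : probability (measurableTypeR R) R) (C : R),
    [/\ mu E = 1%E, 0 < C &
        forall xi : R, `|fourier_transform mu xi|
                       <= (C * (1 + `|xi|) `^ (- beta / 2))%:C].

(* For E empty there is no admissible beta and the value is [sup set0 = 0]. *)
Definition fourier_dim (R : realType) (E : set (measurableTypeR R)) : R :=
  sup [set beta : R | 0 <= beta <= 1 /\ has_fourier_decay E beta].

(* The coefficients of a x1 + b x2 + (-c) y1 + (-d) y2 = 0. *)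
Definition coefficients (a b c d : nat) : 4.-tuple int :=
  [tuple a%:Z; b%:Z; - c%:Z; - d%:Z].

(* Subcollections are indexed by sets of positions, so that equal coefficients
   are counted with multiplicity. *)
Definition genus_one (a b c d : nat) : bool :=
  [forall I : {set 'I_4}, (I != finset.set0) && (I != [set: 'I_4]%SET) ==>
     (\sum_(i in I) tnth (coefficients a b c d) i != 0)].

Definition is_solution (R : realType) (a b c d : nat) (x1 x2 y1 y2 : R) : Prop :=
  a%:R * x1 + b%:R * x2 = c%:R * y1 + d%:R * y2.

(* Meant for a + b = c + d with positive coefficients, where an equation that
   is not of genus one is of genus two. *)
Definition trivial_solution (R : realType) (a b c d : nat) (x1 x2 y1 y2 : R) :
    Prop :=
  if genus_one a b c d then [/\ x1 = x2, x2 = y1 & y1 = y2]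
  else [/\ a = c, b = d, x1 = y1 & x2 = y2] \/
       [/\ a = d, b = c, x1 = y2 & x2 = y1].

(* Main.v *)
(* For t in [1/4, 3/4] let nu_t be the image of mu x mu under
   (x, y) |-> t x + (1 - t) y. Its Fourier transform is
   mu^(t xi) mu^((1 - t) xi) = O(|xi|^-beta) with 2 beta > 1, hence square
   integrable, uniformly in t: the nu_t are bounded in L^2. Therefore the sets
   t F1 + (1 - t) F2, with F1, F2 disjoint compact subsets of E of positive
   measure, all have Lebesgue measure bounded below, and two of them meet once
   enough values t = a / 4M are taken. A common point solves the equation with
   4M = a + b = c + d and {a, b} <> {c, d}; it is nontrivial because F1 and F2
   are disjoint.
   The L^2 bound is used at scale 1/N only, as
   N * sum_j nu_t [j/N, (j+1)/N[ ^2 <= K, which follows from the Fejer kernel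
   and finitely many integer frequencies. Compactness of F1 and F2 turns
   disjointness of the images into a positive distance. *)
Require Import Defs.
From HB Require Import structures.
From mathcomp Require Import all_boot all_order all_algebra.
From mathcomp Require Import all_classical all_reals all_analysis.
From mathcomp Require Import complex.
From mathcomp Require Import measurable_realfun ring lra zify.

Set Implicit Arguments.
Unset Strict Implicit.
Unset Printing Implicit Defensive.

Import Order.TTheory GRing.Theory Num.Theory.
Import numFieldNormedType.Exports.

Local Open Scope classical_set_scope.
Local Open Scope ring_scope.

(** * An explicit bound for the sums of [k ^ -s], [s > 1] *)

Lemma inv_le_ln (R : realType) (k : nat) : (0 < k)%N ->
  k.+1%:R^-1 <= ln (k.+1%:R / k%:R : R).
Proof.
move=> k0; have kR : 0 < k%:R :> R by rewrite ltr0n.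
have k1R : 0 < k.+1%:R :> R by rewrite ltr0n.
rewrite -[X in ln X]invrK invf_div lnV ?posrE ?divr_gt0// lerNr.
have -> : k%:R / k.+1%:R = 1 + - k.+1%:R^-1 :> R.
  by apply: (mulIf (lt0r_neq0 k1R)); rewrite mulfVK ?lt0r_neq0// mulrDl mul1r
    mulNr mulVf ?lt0r_neq0// -natr1 addrK.
by apply: le_ln1Dx; rewrite ltrN2 invf_lt1// ltr1n ltnS.
Qed.

(** A discrete comparison with the integral of [x ^ -s]: the ratio of the two powers on the right is
    [expR ((s - 1) * ln (k.+1 / k))], which [inv_le_ln] and [expR x >= 1 + x] bound below by
    [1 + (s - 1) / k.+1]. *)
Lemma telescope_powR (R : realType) (s : R) (k : nat) : 1 < s -> (0 < k)%N ->
  (s - 1) * k.+1%:R `^ (- s) <= k%:R `^ (1 - s) - k.+1%:R `^ (1 - s).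
Proof.
move=> s1 k0; have kR : 0 < k%:R :> R by rewrite ltr0n.
have k1R : 0 < k.+1%:R :> R by rewrite ltr0n.
have -> : k%:R `^ (1 - s) = k.+1%:R `^ (1 - s) * (k.+1%:R / k%:R) `^ (s - 1).
  rewrite powRM ?invr_ge0 ?ltW// -powR_inv1 ?ltW// -powRrM mulrA.
  rewrite -powRD; last by rewrite lt0r_neq0// implybT.
  by rewrite mulN1r opprB (_ : 1 - s + (s - 1) = 0) ?powRr0 ?mul1r//; ring.
have -> : k.+1%:R `^ (- s) = k.+1%:R `^ (1 - s) * k.+1%:R^-1 :> R.
  rewrite -powR_inv1 ?ltW// -powRD; last by rewrite lt0r_neq0// implybT.
  by congr (_ `^ _); ring.
rewrite mulrCA -{3}[_ `^ _]mulr1 -mulrBr ler_wpM2l ?powR_ge0//.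
rewrite {1}/powR gt_eqF ?divr_gt0// lerBrDl.
apply: le_trans (expR_ge1Dx _); rewrite lerD2l ler_wpM2l ?inv_le_ln//.
by rewrite subr_ge0 ltW.
Qed.

Lemma sum_powR_le (R : realType) (s : R) (n : nat) : 1 < s ->
  \sum_(k < n) k.+1%:R `^ (- s) <= 1 + (s - 1)^-1.
Proof.
move=> s1; have s0 : 0 < s - 1 by rewrite subr_gt0.
case: n => [|n]; first by rewrite big_ord0 addr_ge0// invr_ge0 ltW.
rewrite big_ord_recl powR1 lerD2l -(ler_pM2l s0) divff ?gt_eqF// mulr_sumr.
apply: (@le_trans _ _ (1 - n.+1%:R `^ (1 - s))); last first.
  by rewrite gerBl powR_ge0.
elim: n => [|n IH]; first by rewrite big_ord0 powR1 subrr.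
rewrite big_ord_recr/=.
have := @telescope_powR R s n.+1 s1 isT.
by move: IH; rewrite /bump/= => IH; lra.
Qed.

(** * Lower bound for the Fejer kernel *)

Lemma cos_ge_cos1 (R : realType) (x : R) : `|x| <= 1 -> cos 1 <= cos x.
Proof.
move=> x1; rewrite -(cos_norm x).
have p2 := @pi_ge2 R.
rewrite leNgt ltr_cos ?in_itv/= ?normr_ge0 ?ler01//; first by rewrite -leNgt.
all: by lra.
Qed.

(** Both sides are the squared modulus of the sum of [exp (i n u)]; the second form shows that the
    kernel is nonnegative. *)
Lemma fejer_sqr (R : realType) (N : nat) (u : R) :
  \sum_(n < N) \sum_(m < N) cos ((n%:R - m%:R) * u) =
  (\sum_(n < N) cos (n%:R * u)) ^+ 2 + (\sum_(n < N) sin (n%:R * u)) ^+ 2.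
Proof.
rewrite !expr2 !big_distrlr -big_split; apply: eq_bigr => n _ /=.
by rewrite -big_split; apply: eq_bigr => m _ /=; rewrite mulrBl cosB.
Qed.

(** Every phase [n * u] stays in [-1, 1], where the cosine is at least [cos 1 > 0]; the square of
    the sine sum is dropped. *)
Lemma fejer_ge (R : realType) (N : nat) (u : R) : N%:R * `|u| <= 1 ->
  (N%:R * cos 1) ^+ 2 <= \sum_(n < N) \sum_(m < N) cos ((n%:R - m%:R) * u).
Proof.
move=> Nu; rewrite fejer_sqr ler_wpDr ?sqr_ge0//.
have c1 := @cos1_gt0 R.
have Nc : N%:R * cos 1 <= \sum_(n < N) cos (n%:R * u).
  rewrite mulr_natl -[N in X in X <= _]card_ord -sumr_const.
  apply: ler_sum => n _; apply: cos_ge_cos1.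
  rewrite normrM normr_nat (le_trans _ Nu)// ler_wpM2r// ler_nat.
  exact/ltnW/ltn_ord.
have N0 : 0 <= N%:R * cos 1 :> R by rewrite mulr_ge0// ltW.
by rewrite ler_sqr ?nnegrE// (le_trans N0).
Qed.

(** * Integrals of bounded functions against a probability measure *)

Section bounded_Rintegral.
Context d (T : measurableType d) (R : realType) (P : probability T R).
Implicit Types f : T -> R.

Lemma integrable_of_bounded (M : R) f : measurable_fun setT f ->
  (forall x, `|f x| <= M) -> P.-integrable setT (EFin \o f).
Proof.
move=> mf fM; apply: measurable_bounded_integrable => //.
  by rewrite -ge0_fin_numE ?fin_num_measure.
by exists M; split; [exact: num_real|move=> M' MM' x _; exact: le_trans (fM x) (ltW MM')].
Qed.

Lemma Rintegral_sum (n : nat) (f : 'I_n -> T -> R) :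
  (forall i, P.-integrable setT (EFin \o f i)) ->
  \int[P]_x (\sum_(i < n) f i x) = \sum_(i < n) \int[P]_x f i x.
Proof.
move=> fi; rewrite /Rintegral.
under eq_integral do rewrite -sumEFin.
rewrite integral_sum// -sum_fine// => i _.
by apply: integrable_fin_num => //; exact: fi.
Qed.

Lemma integrable_Rsum (n : nat) (f : 'I_n -> T -> R) :
  (forall i, P.-integrable setT (EFin \o f i)) ->
  P.-integrable setT (EFin \o (fun x => \sum_(i < n) f i x)).
Proof.
move=> fi; have -> : EFin \o (fun x => \sum_(i < n) f i x) =
    (fun x => \sum_(i < n) (EFin \o f i) x)%E.
  by apply/funext => x /=; rewrite sumEFin.
exact: integrable_sum.
Qed.

Lemma Rintegral_indicator (A : set T) : measurable A ->
  \int[P]_x \1_A x = fine (P A).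
Proof. by move=> mA; rewrite /Rintegral integral_indic// setIT. Qed.

Lemma measurable_cosM (X : T -> R) (r : R) : measurable_fun setT X ->
  measurable_fun setT (fun x => cos (r * X x)).
Proof.
move=> mX; apply: (@measurableT_comp _ _ _ _ _ _ (@cos R)).
  by apply: continuous_measurable_fun; exact: continuous_cos.
exact: measurable_funM.
Qed.

Lemma measurable_sinM (X : T -> R) (r : R) : measurable_fun setT X ->
  measurable_fun setT (fun x => sin (r * X x)).
Proof.
move=> mX; apply: (@measurableT_comp _ _ _ _ _ _ (@sin R)).
  by apply: continuous_measurable_fun; exact: continuous_sin.
exact: measurable_funM.
Qed.

Lemma integrable_cosM (X : T -> R) (r : R) : measurable_fun setT X ->
  P.-integrable setT (EFin \o (fun x => cos (r * X x))).
Proof.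
by move=> mX; apply: (@integrable_of_bounded 1) => [|x];
  [exact: measurable_cosM|exact: cos_max].
Qed.

Lemma integrable_sinM (X : T -> R) (r : R) : measurable_fun setT X ->
  P.-integrable setT (EFin \o (fun x => sin (r * X x))).
Proof.
by move=> mX; apply: (@integrable_of_bounded 1) => [|x];
  [exact: measurable_sinM|exact: sin_max].
Qed.

Lemma integrable_RZl f (r : R) : P.-integrable setT (EFin \o f) ->
  P.-integrable setT (EFin \o (fun x => r * f x)).
Proof. by move=> fi; exact: (integrableZl measurableT r fi). Qed.

Lemma integrable_RD f g : P.-integrable setT (EFin \o f) ->
  P.-integrable setT (EFin \o g) ->
  P.-integrable setT (EFin \o (fun x => f x + g x)).
Proof. by move=> fi gi; exact: (integrableD measurableT fi gi). Qed.

End bounded_Rintegral.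

(** * Energy of a random variable at scale 1/N *)

Section energy.
Context d (T : measurableType d) (R : realType) (P : probability T R).

(* The squared modulus of the characteristic function E[exp (i r X)]. *)
Definition sqr_charf (X : T -> R) (r : R) : R :=
  (\int[P]_x cos (r * X x)) ^+ 2 + (\int[P]_x sin (r * X x)) ^+ 2.

(** The inner integral becomes a trigonometric function of [X x] with constant coefficients, hence
    integrable in [x] without Fubini. The equality is between functions so that it can rewrite
    integrability goals too. *)
Lemma Rintegral_cosB (X : T -> R) (r : R) : measurable_fun setT X ->
  (fun x => \int[P]_y cos (r * (X x - X y))) =
  (fun x => (\int[P]_y cos (r * X y)) * cos (r * X x) +
            (\int[P]_y sin (r * X y)) * sin (r * X x)).
Proof.
move=> mX; apply/funext => x; under eq_Rintegral do rewrite mulrBr cosB.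
rewrite RintegralD//; [|exact/integrable_RZl/integrable_cosM
  |exact/integrable_RZl/integrable_sinM].
rewrite !RintegralZl//; [|exact: integrable_sinM|exact: integrable_cosM].
by rewrite [cos _ * _]mulrC [sin _ * _]mulrC.
Qed.

(** The identity [E cos (r (X - X')) = |E exp (i r X)|^2] for an independent copy [X'] of [X],
    written with iterated integrals. *)
Lemma Rintegral2_cosB (X : T -> R) (r : R) : measurable_fun setT X ->
  \int[P]_x (\int[P]_y cos (r * (X x - X y))) = sqr_charf X r.
Proof.
move=> mX; rewrite Rintegral_cosB//.
rewrite RintegralD//; [|exact/integrable_RZl/integrable_cosM
  |exact/integrable_RZl/integrable_sinM].
by rewrite !RintegralZl//; [exact: integrable_sinM|exact: integrable_cosM].
Qed.

(* Integrates the Fejer kernel, at least (N cos 1)^2 on each A j x A j, against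
   P x P. *)
Lemma fejer_energy (X : T -> R) (N m : nat) (A : 'I_m -> set T) :
  measurable_fun setT X -> (forall j, measurable (A j)) -> trivIset setT A ->
  (forall j x y, A j x -> A j y -> N%:R * `|X x - X y| <= 1) ->
  (N%:R * cos 1) ^+ 2 * \sum_(j < m) fine (P (A j)) ^+ 2 <=
  \sum_(n < N) \sum_(k < N) sqr_charf X (n%:R - k%:R).
Proof.
move=> mX mA tA dA; set K := (N%:R * cos 1) ^+ 2.
have icos r x : P.-integrable setT (EFin \o (fun y => cos (r * (X x - X y)))).
  apply: (@integrable_of_bounded _ _ _ _ 1) => [|y]; last exact: cos_max.
  by apply: (@measurable_cosM _ _ _ (fun y => X x - X y)); exact: measurable_funB.
have iA j : P.-integrable setT (EFin \o \1_(A j)).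
  apply: (@integrable_of_bounded _ _ _ _ 1) => [|y]; first exact: measurable_indic.
  by rewrite indicE; case: (_ \in _); rewrite ?normr1 ?normr0.
(* By disjointness at most one term on the left is nonzero, and [fejer_ge] handles it; if there is
   none, the kernel is a sum of two squares. *)
have lower x y : K * \sum_(j < m) \1_(A j) x * \1_(A j) y <=
    \sum_(n < N) \sum_(k < N) cos ((n%:R - k%:R) * (X x - X y)).
  have [[j [Ax Ay]]|nA] := pselect (exists j, A j x /\ A j y).
    rewrite (bigD1 j)//= big1 ?addr0.
      by rewrite !indicE !mem_set// !mulr1; apply: fejer_ge; exact: dA Ax Ay.
    move=> i ij; rewrite indicE memNset ?mul0r// => Aix.
    by move/eqP: ij; apply; apply: (tA i j) => //; exists x.
  rewrite big1 ?mulr0 ?fejer_sqr ?addr_ge0 ?sqr_ge0// => j _.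
  rewrite !indicE; case: (boolP (x \in _)) => [/set_mem Ax|_]; rewrite ?mul0r//.
  by rewrite memNset ?mulr0// => Ay; apply: nA; exists j.
pose h x := \sum_(n < N) \sum_(k < N) \int[P]_y cos ((n%:R - k%:R) * (X x - X y)).
have lower1 x : K * \sum_(j < m) \1_(A j) x * fine (P (A j)) <= h x.
  rewrite /h; under [leRHS]eq_bigr do rewrite -Rintegral_sum//.
  rewrite -Rintegral_sum; last by move=> n; exact: integrable_Rsum.
  under eq_bigr do rewrite -Rintegral_indicator// -RintegralZl//.
  rewrite -Rintegral_sum; last by move=> j; exact: integrable_RZl.
  rewrite -RintegralZl//; last by apply: integrable_Rsum => j; exact: integrable_RZl.
  apply: le_Rintegral => //.
    by apply: integrable_RZl; apply: integrable_Rsum => j; exact: integrable_RZl.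
  by apply: integrable_Rsum => n; exact: integrable_Rsum.
have ih r : P.-integrable setT (EFin \o
    (fun x => \int[P]_y cos (r * (X x - X y)))).
  rewrite Rintegral_cosB//; apply: integrable_RD; apply: integrable_RZl.
    exact: integrable_cosM.
  exact: integrable_sinM.
apply: (@le_trans _ _ (\int[P]_x h x)); last first.
  rewrite /h Rintegral_sum; last by move=> n; exact: integrable_Rsum.
  under eq_bigr do rewrite Rintegral_sum//.
  apply: ler_sum => n _; apply: ler_sum => k _.
  by rewrite Rintegral2_cosB.
have -> : K * \sum_(j < m) fine (P (A j)) ^+ 2 =
    \int[P]_x (K * \sum_(j < m) fine (P (A j)) * \1_(A j) x).
  rewrite RintegralZl//; last by apply: integrable_Rsum => j; exact: integrable_RZl.
  rewrite Rintegral_sum; last by move=> j; exact: integrable_RZl.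
  by congr (_ * _); apply: eq_bigr => j _; rewrite RintegralZl// Rintegral_indicator.
apply: le_Rintegral => //.
- by apply: integrable_RZl; apply: integrable_Rsum => j; exact: integrable_RZl.
- by apply: integrable_Rsum => n; exact: integrable_Rsum.
- move=> x _; apply: le_trans (lower1 x).
  by rewrite le_eqVlt (eq_bigr (fun j => \1_(A j) x * fine (P (A j)))) ?eqxx// => j _; rewrite mulrC.
Qed.

End energy.

(** * Characteristic functions of independent sums *)

Section product.
Context d1 d2 (T1 : measurableType d1) (T2 : measurableType d2) (R : realType).
Context (P : probability T1 R) (Q : probability T2 R).

Lemma integrable_prod (f : T1 -> R) (g : T2 -> R) :
  measurable_fun setT f -> (forall x, `|f x| <= 1) ->
  measurable_fun setT g -> (forall y, `|g y| <= 1) ->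
  (P \x Q)%E.-integrable setT (EFin \o (fun z => f z.1 * g z.2)).
Proof.
move=> mf f1 mg g1; apply: (@integrable_of_bounded _ _ _ (P \x Q)%E 1) => [|z].
  by apply: measurable_funM; apply: measurableT_comp.
by rewrite normrM mulr_ile1.
Qed.

Lemma Rintegral_prod (f : T1 -> R) (g : T2 -> R) :
  measurable_fun setT f -> (forall x, `|f x| <= 1) ->
  measurable_fun setT g -> (forall y, `|g y| <= 1) ->
  \int[(P \x Q)%E]_z (f z.1 * g z.2) = (\int[P]_x f x) * (\int[Q]_y g y).
Proof.
move=> mf f1 mg g1.
have fi := @integrable_of_bounded _ _ _ P 1 _ mf f1.
have gi := @integrable_of_bounded _ _ _ Q 1 _ mg g1.
rewrite {1}/Rintegral -integral12_prod_meas1; last exact: integrable_prod.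
rewrite /fubini_F/=.
under eq_integral => x _.
  under eq_integral do rewrite EFinM.
  rewrite integralZl//.
  rewrite -(@fineK _ (\int[Q]_y (g y)%:E)%E); last exact: integrable_fin_num.
  rewrite -EFinM; over.
by rewrite -RintegralZr.
Qed.

(** Characteristic functions multiply on independent sums; after Fubini this is [(ac - bd)^2 + (bc +
    ad)^2 = (a^2 + b^2) (c^2 + d^2)]. *)
Lemma sqr_charf_prod (X : T1 -> R) (Y : T2 -> R) (r : R) :
  measurable_fun setT X -> measurable_fun setT Y ->
  sqr_charf (P \x Q)%E (fun z => X z.1 + Y z.2) r =
  sqr_charf P X r * sqr_charf Q Y r.
Proof.
move=> mX mY.
have cX := measurable_cosM r mX; have cY := measurable_cosM r mY.
have sX := measurable_sinM r mX; have sY := measurable_sinM r mY.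
have c1 (T : Type) (Z : T -> R) z : `|cos (r * Z z)| <= 1 by exact: cos_max.
have s1 (T : Type) (Z : T -> R) z : `|sin (r * Z z)| <= 1 by exact: sin_max.
rewrite /sqr_charf.
under eq_Rintegral do rewrite mulrDr cosD.
under [X in _ + X ^+ 2]eq_Rintegral do rewrite mulrDr sinD.
rewrite RintegralB//; [|exact: (integrable_prod cX _ cY)
  |exact: (integrable_prod sX _ sY)].
rewrite RintegralD//; [|exact: (integrable_prod sX _ cY)
  |exact: (integrable_prod cX _ sY)].
rewrite (Rintegral_prod cX _ cY)// (Rintegral_prod sX _ sY)//.
by rewrite (Rintegral_prod sX _ cY)// (Rintegral_prod cX _ sY)//; ring.
Qed.

End product.

(** * From Fourier decay to an energy bound uniform in the scale *)

Lemma sqr_charf_scale d (T : measurableType d) (R : realType)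
    (P : probability T R) (X : T -> R) (s r : R) :
  sqr_charf P (fun x => s * X x) r = sqr_charf P X (r * s).
Proof.
by rewrite /sqr_charf; congr (_ ^+ 2 + _ ^+ 2); apply: eq_Rintegral => x _;
  rewrite mulrA.
Qed.

(** Change of normalisation: at [xi = r / (2 pi)] the transform integrates [exp (- i r x)], whose
    sign does not affect the modulus, and squaring doubles the exponent. *)
Lemma fourier_decay_sqr_charf (R : realType) (mu : probability (measurableTypeR R) R)
    (C beta r : R) : 0 < C ->
  (forall xi : R, `|fourier_transform mu xi|
                       <= (C * (1 + `|xi|) `^ (- beta / 2))%:C%C) ->
  sqr_charf mu (fun x : measurableTypeR R => x : R) r <=
    C ^+ 2 * (1 + `|r| / (2 * pi)) `^ (- beta).
Proof.
move=> C0 /(_ (r / (2 * pi))).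
have pi0 := @pi_gt0 R.
have pi2 : 0 < 2 * pi :> R by rewrite mulr_gt0.
have scale (x : R) : r * x = 2 * pi * x * (r / (2 * pi)).
  by move: (2 * pi) pi2 => p p0; field; rewrite gt_eqF.
rewrite normc_def lecR => H.
have -> : sqr_charf mu (fun x : measurableTypeR R => x : R) r =
  complex.Re (fourier_transform mu (r / (2 * pi))) ^+ 2 +
  complex.Im (fourier_transform mu (r / (2 * pi))) ^+ 2.
  rewrite /sqr_charf/=; congr (_ ^+ 2 + _).
    by apply: eq_Rintegral => x _; rewrite cosN -scale.
  rewrite -[RHS]sqrrN -mulN1r; congr (_ ^+ 2).
  under [in RHS]eq_Rintegral do rewrite -scale sinN -mulN1r.
  rewrite RintegralZl ?mulrA ?mulrNN ?mulr1 ?mul1r//.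
  exact: integrable_sinM.
set S := (X in X <= _).
have S0 : 0 <= S by rewrite addr_ge0// sqr_ge0.
rewrite -(sqr_sqrtr S0).
have -> : C ^+ 2 * (1 + `|r| / (2 * pi)) `^ (- beta) =
   (C * (1 + `|r / (2 * pi)|) `^ (- beta / 2)) ^+ 2.
  rewrite exprMn normrM normfV (gtr0_norm pi2); congr (_ * _).
  by rewrite -powR_mulrn ?powR_ge0// -powRrM; congr (_ `^ _); field.
by rewrite ler_sqr ?nnegrE ?sqrtr_ge0// mulr_ge0 ?powR_ge0// ltW.
Qed.

(** With truncated subtraction the argument of [g] is the distance [|n - k|], whose values occur at
    most once on each side of [n]. *)
Lemma sum_dist_le (R : numDomainType) (g : nat -> R) (n N : nat) :
  (forall k, 0 <= g k) -> (n < N)%N ->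
  \sum_(k < N) g ((n - k) + (k - n))%N <= 2 * \sum_(k < N) g k.
Proof.
move=> g0 nN; rewrite -(big_mkord xpredT (fun k => g ((n - k) + (k - n))%N)).
have sub m : (m <= N)%N -> \sum_(0 <= k < m) g k <= \sum_(k < N) g k.
  move=> mN; rewrite -(big_mkord xpredT g) (big_cat_nat _ mN)//=.
  by rewrite lerDl sumr_ge0.
rewrite (big_cat_nat _ (ltnW nN))//= mulr2n mulrDl mul1r lerD//.
  rewrite big_nat_rev/= add0n.
  apply: le_trans (sub n.+1 nN); rewrite big_nat_recl// ler_wpDl//.
  rewrite le_eqVlt; apply/orP; left; apply/eqP; apply: eq_big_nat => k /andP[_ kn].
  by congr g; lia.
rewrite -{1}[n]add0n big_addn.
apply: le_trans (sub (N - n)%N (leq_subr _ _)).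
rewrite le_eqVlt; apply/orP; left; apply/eqP; apply: eq_big_nat => k _.
by congr g; lia.
Qed.

Lemma normr_natB (R : numDomainType) (n k : nat) :
  `|n%:R - k%:R| = ((n - k) + (k - n))%:R :> R.
Proof.
case: (leqP n k) => [nk|/ltnW kn].
  by rewrite distrC -natrB// normr_nat; congr _%:R; lia.
by rewrite -natrB// normr_nat; congr _%:R; lia.
Qed.

(** The two decays multiply, which gives the exponent [2 * beta]. Since [t] and [1 - t] are both at
    least 1/4, the frequencies [r * t] and [r * (1 - t)] stay comparable to [r]. *)
Lemma sqr_charf_conv_le (R : realType) (mu : probability (measurableTypeR R) R)
    (C beta t r : R) : 0 < C -> 0 <= beta ->
  (forall xi : R, `|fourier_transform mu xi|
                       <= (C * (1 + `|xi|) `^ (- beta / 2))%:C%C) ->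
  1 / 4 <= t <= 3 / 4 ->
  sqr_charf (mu \x mu)%E
    (fun z : measurableTypeR R * measurableTypeR R => t * z.1 + (1 - t) * z.2) r <=
  C ^+ 4 * (8 * pi) `^ (2 * beta) * (1 + `|r|) `^ (- (2 * beta)).
Proof.
move=> C0 b0 dec /andP[t1 t2]; have p2 := @pi_ge2 R.
rewrite (@sqr_charf_prod _ _ _ _ _ mu mu (fun x => t * x) (fun x => (1 - t) * x)).
2,3: exact: measurable_funM.
rewrite !sqr_charf_scale.
have bound s : 1 / 4 <= s -> sqr_charf mu (fun x : measurableTypeR R => x) (r * s) <=
    C ^+ 2 * ((8 * pi) `^ beta * (1 + `|r|) `^ (- beta)).
  move=> s4; apply: le_trans (fourier_decay_sqr_charf _ C0 dec) _.
  rewrite ler_wpM2l ?sqr_ge0//.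
  have p8 : 0 < 8 * pi :> R by lra.
  have r1 : 0 < 1 + `|r| by rewrite ltr_pwDl.
  (* The constant terms compare because [8 * pi >= 1], the terms in [|r|] because [s >= 1/4]. *)
  have scale : (8 * pi)^-1 * (1 + `|r|) <= 1 + `|r * s| / (2 * pi).
    have q0 : 0 < pi^-1 :> R by rewrite invr_gt0; lra.
    have q1 : pi^-1 <= 2^-1 :> R by rewrite lef_pV2 ?posrE//; lra.
    have rs : `|r| * pi^-1 * 4^-1 <= `|r * s| * pi^-1.
      rewrite normrM (ger0_norm (_ : 0 <= s)); last by lra.
      have : 0 <= `|r| * pi^-1 * (s - 4^-1).
        by apply: mulr_ge0; [rewrite mulr_ge0// ltW|lra].
      by lra.
    by rewrite !invfM; lra.
  have -> : (8 * pi) `^ beta * (1 + `|r|) `^ (- beta) =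
      ((8 * pi)^-1 * (1 + `|r|)) `^ (- beta).
    rewrite [in RHS]powRM ?invr_ge0 ?ltW//; congr (_ * _).
    by rewrite -powR_inv1 ?ltW// -powRrM mulN1r opprK.
  have pos : 0 < (8 * pi)^-1 * (1 + `|r|) by rewrite mulr_gt0 ?invr_gt0.
  rewrite !powRN lef_pV2 ?posrE ?powR_gt0//; last exact: lt_le_trans scale.
  by apply: ge0_ler_powR => //; rewrite nnegrE ltW// (lt_le_trans pos).
apply: (@le_trans _ _ ((C ^+ 2 * ((8 * pi) `^ beta * (1 + `|r|) `^ (- beta))) ^+ 2)).
  by rewrite [leRHS]expr2 ler_pM// ?addr_ge0 ?sqr_ge0// bound//; lra.
have sqr_powR (x y : R) : (x `^ y) ^+ 2 = x `^ (2 * y).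
  by rewrite -powR_mulrn ?powR_ge0// -powRrM mulrC.
by rewrite exprMn -exprM exprMn !sqr_powR mulrA mulrN.
Qed.

(** In [fejer_energy] the left side carries [N ^ 2], while the double sum is at most [N] times a
    convergent series because [2 * beta > 1]. One factor [N] remains, and [K] depends on [C] and
    [beta] only. *)
Lemma energy_bound (R : realType) (mu : probability (measurableTypeR R) R)
    (C beta : R) : 0 < C -> 1 / 2 < beta ->
  (forall xi : R, `|fourier_transform mu xi|
                       <= (C * (1 + `|xi|) `^ (- beta / 2))%:C%C) ->
  exists2 K : R, 0 < K & forall (t : R) (N m : nat)
      (A : 'I_m -> set (measurableTypeR R * measurableTypeR R)),
    1 / 4 <= t <= 3 / 4 -> (0 < N)%N ->
    (forall j, measurable (A j)) -> trivIset setT A ->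
    (forall j z w, A j z -> A j w ->
      N%:R * `|(t * z.1 + (1 - t) * z.2) - (t * w.1 + (1 - t) * w.2)| <= 1) ->
    N%:R * \sum_(j < m) fine ((mu \x mu)%E (A j)) ^+ 2 <= K.
Proof.
move=> C0 b2 dec; set D := C ^+ 4 * (8 * pi) `^ (2 * beta).
have D0 : 0 < D by rewrite mulr_gt0 ?exprn_gt0 ?powR_gt0 ?mulr_gt0 ?pi_gt0.
have c1 := @cos1_gt0 R.
set S := 1 + (2 * beta - 1)^-1.
have S0 : 0 < S by rewrite ltr_wpDr// invr_ge0; lra.
exists (2 * D * S / (cos 1 ^+ 2)).
  by apply: divr_gt0; rewrite ?exprn_gt0// (mulr_gt0 _ S0)// (mulr_gt0 _ D0).
move=> t N m A t14 N0 mA tA dA.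
have mX : measurable_fun setT
    (fun z : measurableTypeR R * measurableTypeR R => t * z.1 + (1 - t) * z.2).
  by apply: measurable_funD; apply: measurable_funM.
have NR : 0 < N%:R :> R by rewrite ltr0n.
rewrite ler_pdivlMr ?exprn_gt0// -(ler_pM2l NR).
have := @fejer_energy _ _ _ (mu \x mu)%E _ N m A mX mA tA dA.
move: (\sum_(j < m) _) => Q.
have -> : N%:R * (N%:R * Q * cos 1 ^+ 2) = (N%:R * cos 1) ^+ 2 * Q by ring.
move/le_trans; apply.
have -> : N%:R * (2 * D * S) = \sum_(n < N) 2 * (D * S).
  by rewrite sumr_const card_ord mulr_natl mulrA.
apply: ler_sum => n _.
pose g k := D * k.+1%:R `^ (- (2 * beta)).
have g0 k : 0 <= g k by rewrite mulr_ge0 ?powR_ge0// ltW.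
apply: (@le_trans _ _ (\sum_(k < N) g ((n - k) + (k - n))%N)).
  apply: ler_sum => k _; apply: le_trans (sqr_charf_conv_le _ C0 _ dec t14) _.
    by lra.
  by rewrite normr_natB nat1r.
apply: le_trans (sum_dist_le g0 (ltn_ord n)) _.
rewrite -mulr_sumr; apply: ler_wpM2l => //; apply: ler_wpM2l; first exact: ltW.
by apply: sum_powR_le; lra.
Qed.

(** * Inner regularity of Borel probability measures on the line *)

Lemma decreasing_mu_lt d (T : measurableType d) (R : realType)
    (P : probability T R) (F : (set T)^nat) (e : R) :
  (forall n, measurable (F n)) -> (forall n m, (n <= m)%N -> F m `<=` F n) ->
  \bigcap_n F n = set0 -> 0 < e -> exists n, (P (F n) < e%:E)%E.
Proof.
move=> mF dF F0 e0; apply: contrapT => /forallNP nF.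
have cF : (P \o F) x @[x --> \oo] --> P (\bigcap_n F n).
  apply: nonincreasing_cvg_mu => //.
  - by rewrite -ge0_fin_numE ?fin_num_measure.
  - by rewrite F0.
  - by move=> n m nm; apply/subsetPset; exact: dF.
have : (e%:E <= P (\bigcap_n F n))%E.
  apply: (cvge_ge _ cF); apply: nearW => n.
  by rewrite leNgt; apply/negP; exact: nF.
by rewrite F0 measure0 lee_fin leNgt e0.
Qed.

Section inner_regularity.
Context (R : realType) (mu : probability (measurableTypeR R) R).

(** Approximation by closed rather than compact sets; boundedness enters only in
    [compact_positive]. *)
Definition inner_regular (A : set (measurableTypeR R)) := forall e : R, 0 < e ->
  exists F : set R, [/\ closed F, F `<=` A & (mu (A `\` F) <= e%:E)%E].

Lemma closed_inner_regular (A : set R) : closed A -> inner_regular A.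
Proof. by move=> cA e e0; exists A; split=> //; rewrite setDv measure0 lee_fin ltW. Qed.

(** The errors [e / 2 ^ n.+1] sum to [e]. Serves both countable unions and countable
    intersections. *)
Lemma inner_regular_seq (A : (set (measurableTypeR R))^nat) (e : R) :
  (forall n, measurable (A n)) -> (forall n, inner_regular (A n)) -> 0 < e ->
  exists F : (set R)^nat, [/\ forall n, closed (F n), forall n, F n `<=` A n &
    (mu (\bigcup_n (A n `\` F n)) <= e%:E)%E].
Proof.
move=> mA iA e0.
have /choice[F FP] : forall n, exists F : set R, [/\ closed F, F `<=` A n &
    (mu (A n `\` F) <= (e / (2 ^ n.+1)%:R)%:E)%E].
  by move=> n; apply: iA; rewrite divr_gt0// ltr0n expn_gt0.
have cF n : closed (F n) by have [] := FP n.
exists F; split => [//|n|]; first by have [] := FP n.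
have mD n : measurable (A n `\` F n : set (measurableTypeR R)).
  by apply: measurableD => //; exact: closed_measurable.
apply: le_trans (epsilon_trick0 xpredT (ltW e0)).
apply: le_trans (measure_sigma_subadditive mu mD _ (@subset_refl _ _)) _.
  by apply: bigcup_measurable => n _.
apply: lee_nneseries => n _ //.
by have [] := FP n.
Qed.

(** A countable union of closed sets need not be closed, so it is cut to finitely many: [e / 2] pays
    for the tail [D n], by continuity from above, and [e / 2] for the approximations. *)
Lemma inner_regular_bigcup (A : (set (measurableTypeR R))^nat) :
  (forall n, measurable (A n)) -> (forall n, inner_regular (A n)) ->
  inner_regular (\bigcup_n A n).
Proof.
move=> mA iA e e0; have e2 : 0 < e / 2 by rewrite divr_gt0.
have [F [cF FA muF]] := inner_regular_seq mA iA e2.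
have mF n : measurable (F n : set (measurableTypeR R)) by exact: closed_measurable.
have mUA : measurable (\bigcup_n A n) by exact: bigcup_measurable.
pose D n : set (measurableTypeR R) := \bigcup_n A n `\` \big[setU/set0]_(k < n) A k.
have mD n : measurable (D n).
  by apply: measurableD => //; exact: bigsetU_measurable.
have [n muD] : exists n, (mu (D n) < (e / 2)%:E)%E.
  apply: decreasing_mu_lt => //.
    move=> n m nm x [Ux nAx]; split=> //; apply: contra_not nAx.
    rewrite -!bigcup_mkord => -[k kn Akx]; exists k => //=.
    exact: leq_trans kn nm.
  rewrite -subset0 => x Dx; have [[k _ Akx] _] := Dx 0%N I.
  have [_] := Dx k.+1 I; apply.
  by rewrite big_ord_recr/=; right.
exists (\big[setU/set0]_(k < n) F k); split.
- by apply: closed_bigsetU => k _; exact: cF.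
- by move=> x; rewrite -bigcup_mkord => -[k _ /FA Akx]; exists k.
rewrite (splitr e) EFinD; apply: (@le_trans _ _ (mu (D n `|` \bigcup_n (A n `\` F n)))).
  apply: le_measure; rewrite ?inE.
  - by apply: measurableD => //; exact: bigsetU_measurable.
  - apply: measurableU => //; apply: bigcup_measurable => k _.
    exact: measurableD.
  move=> x [UAx nFx].
  have [[k _ [Akx Fkx]]|nx] := pselect ((\bigcup_n (A n `\` F n)) x).
    by right; exists k.
  left; split=> // Ax; apply: nFx.
  move: Ax; rewrite -!bigcup_mkord => -[k kn Akx]; exists k => //.
  by apply: contrapT => nFk; apply: nx; exists k.
apply: le_trans (measureU2 _ _ _) _ => //; last by rewrite leeD// ltW.
by apply: bigcup_measurable => k _; exact: measurableD.
Qed.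

Lemma inner_regular_bigcap (A : (set (measurableTypeR R))^nat) :
  (forall n, measurable (A n)) -> (forall n, inner_regular (A n)) ->
  inner_regular (\bigcap_n A n).
Proof.
move=> mA iA e e0; have [F [cF FA muF]] := inner_regular_seq mA iA e0.
exists (\bigcap_n F n); split.
- exact: closed_bigI.
- by move=> x Fx n _; apply: FA; exact: Fx.
apply: le_trans muF; apply: le_measure; rewrite ?inE.
- by apply: measurableD; apply: bigcap_measurable => // n _; exact: closed_measurable.
- by apply: bigcup_measurable => n _; apply: measurableD => //; exact: closed_measurable.
move=> x [Ax nFx]; apply: contrapT => nU; apply: nFx => n _.
by apply: contrapT => nFn; apply: nU; exists n => //; split=> //; exact: Ax.
Qed.

Lemma measurable_inner_regular (A : set (measurableTypeR R)) :
  measurable A -> inner_regular A.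
Proof.
move=> mA; have : (@RGenOInfty.G R).-sigma.-measurable A by rewrite -RGenOInfty.measurableE.
(* The sets which are inner regular together with their complement form a
   sigma-algebra. *)
suff sub : (@RGenOInfty.G R).-sigma.-measurable `<=`
    [set A | [/\ measurable A, inner_regular A & inner_regular (~` A)]].
  by move=> /sub[].
move=> {A mA}.
apply: smallest_sub; last first.
  move=> _ [x ->].
  have mx : measurable (`]x, +oo[%classic : set (measurableTypeR R)) by [].
  split=> //.
    (* The generating open rays are not closed, but they are countable unions of closed rays. *)
    have -> : `]x, +oo[%classic = \bigcup_n `[x + n.+1%:R^-1, +oo[%classic.
      exact: itvoyEbigcup.
    apply: inner_regular_bigcup => n //.
    by apply: closed_inner_regular; exact: rray_closed.
  rewrite setCitvr; apply: closed_inner_regular; exact: lray_closed.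
split.
- split=> //; first exact: closed_inner_regular closed0.
  by rewrite setC0; exact: closed_inner_regular closedT.
- move=> A [mA iA iCA]; rewrite setTD; split=> //; first exact: measurableC.
  by rewrite setCK.
- move=> A HA; have mA n := let: And3 m _ _ := HA n in m; split.
  + by apply: bigcup_measurable => n _.
  + by apply: inner_regular_bigcup => // n; have [] := HA n.
  + rewrite setC_bigcup; apply: inner_regular_bigcap => n.
      exact: measurableC.
    by have [] := HA n.
Qed.
End inner_regularity.
(** A closed subset that misses at most half of the mass of [A] keeps positive mass, and it is
    compact inside [[a, b]]. *)
Lemma compact_positive (R : realType) (mu : probability (measurableTypeR R) R)
    (A : set (measurableTypeR R)) (a b : R) : measurable A -> A `<=` `[a, b] ->
  (0 < mu A)%E -> exists F : set R, [/\ compact F, F `<=` A & (0 < mu F)%E].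
Proof.
move=> mA Aab muA.
have fA : mu A \is a fin_num by rewrite fin_num_measure.
have m0 : 0 < fine (mu A) by rewrite fine_gt0// muA/= -ge0_fin_numE.
have e0 : 0 < fine (mu A) / 2 by rewrite divr_gt0.
have [F [cF FA muF]] := measurable_inner_regular mu mA e0.
have mF : measurable (F : set (measurableTypeR R)) by exact: closed_measurable.
exists F; split => //.
  by apply: (subclosed_compact cF (@segment_compact _ a b)) => x /FA /Aab.
rewrite lt0e measure_ge0 andbT; apply/eqP => F0; move: muF.
have -> : mu (A `\` F) = mu A.
  rewrite measureD//; last by rewrite -ge0_fin_numE.
  by rewrite (setIidr FA) [X in (_ - X)%E]F0 sube0.
by rewrite -(fineK fA) lee_fin; lra.
Qed.

(** * The measures [nu_t] on the cells of length 1/N *)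

(** The law of [mix t] under [mu \x mu] is [nu_t]. *)
Definition mix (R : realType) (t : R)
  (z : measurableTypeR R * measurableTypeR R) : R := t * z.1 + (1 - t) * z.2.

Definition cell (R : realType) (N j : nat) : set R :=
  [set` `[j%:R / N%:R, j.+1%:R / N%:R[].

Lemma cellP (R : realType) (N j : nat) (u : R) : (0 < N)%N ->
  cell N j u <-> j%:R <= N%:R * u < j.+1%:R.
Proof.
move=> N0; have NR : 0 < N%:R :> R by rewrite ltr0n.
by rewrite /cell/= in_itv/= ler_pdivrMr// ltr_pdivlMr// mulrC.
Qed.

(** Cells are half-open, so the point 1 needs the additional cell of index [N]. *)
Lemma cell_cover (R : realType) (N : nat) (u : R) : (0 < N)%N -> 0 <= u <= 1 ->
  exists j : 'I_N.+1, cell N j u.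
Proof.
move=> N0 /andP[u0 u1]; have Nu : 0 <= N%:R * u by rewrite mulr_ge0.
have jN : (Num.truncn (N%:R * u) < N.+1)%N.
  by rewrite ltnS -(ler_nat R) (@le_trans _ _ (N%:R * u))// ?truncn_le// ler_piMr.
by exists (Ordinal jN); apply/cellP => //=; exact: truncn_itv.
Qed.

Lemma cell_eq (R : realType) (N j k : nat) (u : R) : (0 < N)%N ->
  cell N j u -> cell N k u -> j = k.
Proof.
move=> N0 /(cellP _ _ N0)/andP[ju uj] /(cellP _ _ N0)/andP[ku uk].
have := le_lt_trans ju uk; have := le_lt_trans ku uj.
by rewrite !ltr_nat !ltnS => jk kj; apply/eqP; rewrite eqn_leq jk kj.
Qed.

Lemma cell_dist (R : realType) (N j : nat) (u v : R) : (0 < N)%N ->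
  cell N j u -> cell N j v -> N%:R * `|u - v| < 1.
Proof.
move=> N0 /(cellP _ _ N0)/andP[ju uj] /(cellP _ _ N0)/andP[ku uk].
rewrite -natr1 in uj uk.
have -> : N%:R * `|u - v| = `|N%:R * u - N%:R * v| by rewrite -mulrBr normrM normr_nat.
by rewrite ltr_distl; apply/andP; split; lra.
Qed.

Lemma measure_cover_le d (T : measurableType d) (R : realType)
    (P : probability T R) (A : set T) (c : (set T)^nat) (n : nat) :
  measurable A -> (forall k, measurable (c k)) ->
  (forall x, A x -> exists k : 'I_n, c k x) ->
  (P A <= \sum_(k < n) P (A `&` c k))%E.
Proof.
move=> mA mc Ac; apply: (content_subadditive P (F := fun k => A `&` c k)) => //.
  by move=> k _; exact: measurableI.
move=> x Ax; have [k kx] := Ac x Ax.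
by rewrite -(bigcup_mkord n (fun k => A `&` c k)); exists k => /=.
Qed.

Lemma measurable_mix (R : realType) (t : R) : measurable_fun setT (mix t).
Proof. by apply: measurable_funD; apply: measurable_funM. Qed.

Lemma measurable_mix_cell (R : realType) (t : R) (N j : nat) :
  measurable (mix t @^-1` cell N j).
Proof.
rewrite -[X in measurable X]setTI; apply: measurable_mix => //.
exact: measurable_itv.
Qed.

Lemma cell_energy_bound (R : realType) (mu : probability (measurableTypeR R) R)
    (C beta : R) : 0 < C -> 1 / 2 < beta ->
  (forall xi : R, `|fourier_transform mu xi|
                       <= (C * (1 + `|xi|) `^ (- beta / 2))%:C%C) ->
  exists2 K : R, 0 < K & forall (t : R) (N : nat), 1 / 4 <= t <= 3 / 4 ->
    (0 < N)%N ->
    N%:R * \sum_(j < N.+1) fine ((mu \x mu)%E (mix t @^-1` cell N j)) ^+ 2 <= K.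
Proof.
move=> C0 b2 dec; have [K K0 HK] := energy_bound C0 b2 dec.
exists K => // t N t14 N0; apply: (HK t) => //.
- by move=> j; exact: measurable_mix_cell.
- by move=> i j _ _ [z [zi zj]]; apply: val_inj; exact: cell_eq zi zj.
- by move=> j z w zj wj; exact/ltW/(cell_dist N0 zj wj).
Qed.

(* If mu gave each cell [j/N, (j+1)/N[ measure 0 or 1, then so would nu_(1/2) by
   convexity, contradicting the energy bound for N > K. *)
Lemma disjoint_compacts (R : realType) (mu : probability (measurableTypeR R) R)
    (E : set (measurableTypeR R)) (K : R) : measurable E -> E `<=` `[0, 1] ->
  mu E = 1%E ->
  (forall (t : R) (N : nat), 1 / 4 <= t <= 3 / 4 -> (0 < N)%N ->
    N%:R * \sum_(j < N.+1) fine ((mu \x mu)%E (mix t @^-1` cell N j)) ^+ 2 <= K) ->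
  exists F1 F2 : set R, [/\ compact F1, compact F2, F1 `<=` E & F2 `<=` E] /\
    [/\ F1 `&` F2 = set0, (0 < mu F1)%E & (0 < mu F2)%E].
Proof.
move=> mE E01 muE HK; pose N := (Num.truncn `|K|).+1.
have KN : K < N%:R by rewrite (le_lt_trans (ler_norm K))// truncnS_gt.
pose c (j : nat) : set (measurableTypeR R) := cell N j.
have mc j : measurable (c j) by exact: measurable_itv.
(* If a cell splits the mass of [E], one compact set is taken inside it and the other outside. *)
have [[j [j0 j1]]|nj] :=
    pselect (exists j, (0 < mu (E `&` c j))%E /\ (0 < mu (E `\` c j))%E).
  have [F1 [cF1 F1E mF1]] :=
    compact_positive (measurableI _ _ mE (mc j)) (subIset (or_introl E01)) j0.
  have [F2 [cF2 F2E mF2]] :=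
    compact_positive (measurableD mE (mc j)) (subset_trans (@subDsetl _ _ _) E01) j1.
  exists F1, F2; split; split => //.
  - by move=> x /F1E[].
  - by move=> x /F2E[].
  - by rewrite -subset0 => x [/F1E[_ ?] /F2E[_]].
have [j jE] : exists j : 'I_N.+1, (0 < mu (E `&` c j))%E.
  apply: contrapT => /forallNP n0.
  have : (mu E <= \sum_(j < N.+1) mu (E `&` c j))%E.
    apply: measure_cover_le => // x Ex.
    by have := E01 x Ex; rewrite /= in_itv/= => /(@cell_cover R N x isT).
  rewrite muE big1 ?lee_fin ?ler10// => k _; apply/eqP.
  by have := n0 k; rewrite lt0e measure_ge0 andbT => /negP; rewrite negbK.
have Dj : mu (E `\` c j) = 0%E.
  apply: contrapT => /eqP D0; apply: nj; exists (j : nat); split => //.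
  by rewrite lt0e D0 measure_ge0.
have cj : mu (c j) = 1%E.
  apply/eqP; rewrite eq_le probability_le1//= -muE (measureDI mu mE (mc j)).
  rewrite [X in (X + _)%E]Dj add0e; apply: le_measure; rewrite ?inE//.
  exact: measurableI.
have t14 : 1 / 4 <= (1 / 2 : R) <= 3 / 4 by apply/andP; split; lra.
(* The term of index [j] alone contributes 1 to the energy sum. *)
suff : N%:R <= K by rewrite leNgt KN.
apply: le_trans (HK (1 / 2) N t14 isT); rewrite ler_peMr// (bigD1 j)//=.
apply: ler_wpDr; first by apply: sumr_ge0 => k _; exact: sqr_ge0.
suff -> : (mu \x mu)%E (mix (1 / 2) @^-1` cell N j) = 1%E by rewrite expr1n.
apply/eqP; rewrite eq_le probability_le1/=; last exact: measurable_mix_cell.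
have <- : (mu \x mu)%E (c j `*` c j) = 1%E.
  by rewrite product_measure1E// -[RHS]mule1; congr (_ * _)%E; exact: cj.
apply: le_measure; rewrite ?inE; [exact: measurableX|exact: measurable_mix_cell|].
move=> [x y] [/= cx cy]; rewrite /mix/=.
move: cx cy; rewrite /c/cell/= !in_itv/= => /andP[x1 x2] /andP[y1 y2].
by apply/andP; split; lra.
Qed.

(** * Counting: few families of bounded energy have disjoint supports *)

Lemma sqr_sum_le (R : realDomainType) (m : nat) (y : 'I_m -> R) :
  (\sum_(j < m) y j) ^+ 2 <= m%:R * \sum_(j < m) y j ^+ 2.
Proof.
have -> : m%:R * \sum_(j < m) y j ^+ 2 = \sum_(j < m) \sum_(k < m) y j ^+ 2.
  by under [RHS]eq_bigr do rewrite sumr_const card_ord -mulr_natl; rewrite -mulr_sumr.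
rewrite expr2 big_distrlr/= -(ler_pM2l (ltr0n R 2)) !mulr2n !mulrDl !mul1r.
rewrite [X in _ <= _ + X]exchange_big/= -!big_split/=; apply: ler_sum => j _.
rewrite -!big_split/=; apply: ler_sum => k _.
by have := sqr_ge0 (y j - y k); nra.
Qed.

(* Cauchy-Schwarz on sum_j sum_i q i j. *)
Lemma disjoint_support_bound (R : realFieldType) (M m N : nat) (p K : R)
    (q : 'I_M -> 'I_m -> R) : (0 < M)%N -> (m <= 2 * N)%N -> 0 <= p ->
  (forall j i k, q i j != 0 -> q k j != 0 -> i = k) ->
  (forall i, p <= \sum_(j < m) q i j) ->
  (forall i, N%:R * \sum_(j < m) q i j ^+ 2 <= K) ->
  M%:R * p ^+ 2 <= 2 * K.
Proof.
move=> M0 mN p0 dq pq qK; have MR : 0 < M%:R :> R by rewrite ltr0n.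
pose y j := \sum_(i < M) q i j.
(* For each [j] at most one [q i j] is nonzero, so there are no cross terms. *)
have y2 j : y j ^+ 2 = \sum_(i < M) q i j ^+ 2.
  have [[i qi]|q0] := pselect (exists i, q i j != 0).
    have qk k : k != i -> q k j = 0.
      by move=> ki; apply: contrapT => /eqP qk; move/eqP: ki; apply; exact: dq qk qi.
    rewrite /y (bigD1 i)//= big1 ?addr0; last exact: qk.
    by rewrite (bigD1 i)//= big1 ?addr0// => k /qk ->; rewrite expr0n.
  have qk k : q k j = 0 by apply: contrapT => /eqP qk; apply: q0; exists k.
  by rewrite /y !big1 ?expr0n// => k _; rewrite qk ?expr0n.
have yM : M%:R * p <= \sum_(j < m) y j.
  rewrite exchange_big/= mulr_natl -[in leLHS](card_ord M) -sumr_const.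
  by apply: ler_sum => i _.
have yK : N%:R * \sum_(j < m) y j ^+ 2 <= M%:R * K.
  under eq_bigr do rewrite y2.
  rewrite exchange_big/= mulr_sumr mulr_natl -[in leRHS](card_ord M) -sumr_const.
  by apply: ler_sum => i _.
have y0 : 0 <= \sum_(j < m) y j ^+ 2 by apply: sumr_ge0 => j _; exact: sqr_ge0.
have mNR : m%:R <= 2 * N%:R :> R by rewrite -natrM ler_nat.
have := sqr_sum_le y.
have Mp : 0 <= M%:R * p by rewrite mulr_ge0// ltW.
have : (M%:R * p) ^+ 2 <= (\sum_(j < m) y j) ^+ 2.
  by rewrite ler_sqr ?nnegrE// (le_trans Mp).
have := ler_wpM2r y0 mNR.
move=> h1 h2 h3; rewrite -(ler_pM2l MR).
have -> : M%:R * (M%:R * p ^+ 2) = (M%:R * p) ^+ 2 by ring.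
apply: le_trans h2 (le_trans h3 (le_trans h1 _)); lra.
Qed.

(** * Separation of compact images, and a collision between two of them *)

(** The distance attains its minimum on a compact set of quadruples, and that minimum is not 0. *)
Lemma compact_images_separated (R : realType) (F1 F2 : set R) (s t : R) :
  compact F1 -> compact F2 ->
  (forall x1 x2 y1 y2, F1 x1 -> F2 x2 -> F1 y1 -> F2 y2 ->
    s * x1 + (1 - s) * x2 <> t * y1 + (1 - t) * y2) ->
  exists2 delta : R, 0 < delta &
    forall x1 x2 y1 y2, F1 x1 -> F2 x2 -> F1 y1 -> F2 y2 ->
    delta <= `|(s * x1 + (1 - s) * x2) - (t * y1 + (1 - t) * y2)|.
Proof.
move=> cF1 cF2 dst.
pose f (p : (R * R) * (R * R)) :=
  `|(s * p.1.1 + (1 - s) * p.1.2) - (t * p.2.1 + (1 - t) * p.2.2)|.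
pose B := (F1 `*` F2) `*` (F1 `*` F2).
have cB : compact B by apply: compact_setX; exact: compact_setX.
have cf : continuous f.
  move=> p; apply: cvg_norm.
  by apply: cvgB; apply: cvgD; apply: cvgM; do ?[exact: cvg_cst];
    apply: continuous_comp; do ?[exact: cvg_fst|exact: cvg_snd].
have [B0|nB] := pselect (B !=set0); last first.
  exists 1 => // x1 x2 y1 y2 *; exfalso; apply: nB.
  by exists ((x1, x2), (y1, y2)).
have [[[x1 x2] [y1 y2]] /set_mem[[/= Fx1 Fx2] [/= Fy1 Fy2]] fmin] :=
  compact_EVT_min B0 cB (continuous_subspaceT cf).
exists (f ((x1, x2), (y1, y2))).
  by rewrite normr_gt0 subr_eq0; apply/eqP; exact: dst.
by move=> a b c d *; apply: (fmin ((a, b), (c, d))); rewrite inE.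
Qed.

Lemma exists_decay_gt_half (R : realType) (E : set (measurableTypeR R)) :
  1 / 2 < fourier_dim E -> exists2 beta : R, 1 / 2 < beta & has_fourier_decay E beta.
Proof.
move=> hdim; set S := [set beta : R | 0 <= beta <= 1 /\ has_fourier_decay E beta].
have [S0|S0] := pselect (S !=set0); last first.
  (* The convention [sup set0 = 0] rules out an empty set of exponents. *)
  move: hdim; rewrite /fourier_dim -/S.
  have -> : S = set0 by apply/eqP; apply: contrapT => /negP/set0P.
  by rewrite sup0; lra.
have supS : has_sup S by split=> //; exists 1 => b [/andP[]].
have [b [_ Hb] bhalf] := sup_gt S0 hdim.
by exists b.
Qed.

(** Otherwise the [M] images of [F1 x F2] are pairwise at positive distance, so for [N] large each
    cell meets at most one of them. Each carries mass [mu F1 * mu F2] with energy at most [K], and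
    [disjoint_support_bound] contradicts the size of [M]. *)
Lemma mix_collision (R : realType) (mu : probability (measurableTypeR R) R)
    (F1 F2 : set R) (K : R) (M : nat) (t : 'I_M -> R) :
  compact F1 -> compact F2 -> F1 `<=` `[0, 1] -> F2 `<=` `[0, 1] -> (0 < M)%N ->
  (forall i, 1 / 4 <= t i <= 3 / 4) ->
  2 * K < M%:R * (fine (mu F1) * fine (mu F2)) ^+ 2 ->
  (forall (t : R) (N : nat), 1 / 4 <= t <= 3 / 4 -> (0 < N)%N ->
    N%:R * \sum_(j < N.+1) fine ((mu \x mu)%E (mix t @^-1` cell N j)) ^+ 2 <= K) ->
  exists i k x1 x2 y1 y2, [/\ i != k, F1 x1 /\ F2 x2, F1 y1 /\ F2 y2 &
    t i * x1 + (1 - t i) * x2 = t k * y1 + (1 - t k) * y2].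
Proof.
move=> cF1 cF2 F101 F201 M0 t14 MK HK; apply: contrapT => no.
have mF (F : set R) : compact F -> measurable (F : set (measurableTypeR R)).
  exact: compact_measurable.
have /choice[delta deltaP] : forall ik : 'I_M * 'I_M, exists delta : R,
    ik.1 != ik.2 -> 0 < delta /\
    forall x1 x2 y1 y2, F1 x1 -> F2 x2 -> F1 y1 -> F2 y2 ->
    delta <= `|(t ik.1 * x1 + (1 - t ik.1) * x2) - (t ik.2 * y1 + (1 - t ik.2) * y2)|.
  move=> [i k]; have [->|ik] := eqVneq i k; first by exists 0.
  have [|d d0 dP] := @compact_images_separated _ _ _ (t i) (t k) cF1 cF2.
    by move=> x1 x2 y1 y2 F1x F2x F1y F2y eq; apply: no; exists i, k, x1, x2, y1, y2.
  by exists d.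
(* Makes [1 / N] at most every off-diagonal separation; the successor keeps [N] positive even when
   only diagonal pairs exist. *)
pose N := (\max_(ik : 'I_M * 'I_M) (Num.truncn (delta ik)^-1).+1)%N.
have dN i k : i != k -> 1 <= N%:R * delta (i, k).
  move=> ik; have [d0 _] := deltaP (i, k) ik.
  rewrite -ler_pdivrMr// div1r.
  apply: (@le_trans _ _ ((Num.truncn (delta (i, k))^-1).+1)%:R).
    exact/ltW/truncnS_gt.
  by rewrite ler_nat (leq_bigmax (i, k)).
have N0 : (0 < N)%N.
  pose i0 : 'I_M := Ordinal M0.
  by apply: leq_trans (leq_bigmax (i0, i0)).
pose A i j : set (measurableTypeR R * measurableTypeR R) :=
  (F1 `*` F2) `&` (mix (t i) @^-1` cell N j).
have mX : measurable (F1 `*` F2 : set (measurableTypeR R * measurableTypeR R)).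
  by apply: measurableX; exact: mF.
have mA i j : measurable (A i j) by apply: measurableI => //; exact: measurable_mix_cell.
have fin_prod (B : set (measurableTypeR R * measurableTypeR R)) :
    measurable B -> (mu \x mu)%E B \is a fin_num.
  exact: (@fin_num_measure _ _ _ (mu \x mu : probability _ _)%E).
suff : M%:R * (fine (mu F1) * fine (mu F2)) ^+ 2 <= 2 * K by rewrite leNgt MK.
apply: (@disjoint_support_bound _ M N.+1 N _ _
  (fun i j => fine ((mu \x mu)%E (A i j)))) => //.
- by rewrite mul2n -addnn -addn1 leq_add2l.
- by rewrite mulr_ge0// fine_ge0.
- move=> j i k.
  have nonempty l : fine ((mu \x mu)%E (A l j)) != 0 -> A l j !=set0.
    by move=> Al; apply/set0P; apply: contra_neq Al => ->; rewrite measure0.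
  move=> /nonempty[z [[z1 z2] zj]] /nonempty[w [[w1 w2] wj]].
  apply: contrapT => /eqP ik; have [_ dP] := deltaP (i, k) ik.
  (* Points of one cell are less than [1 / N] apart, points of two different images at least
     [1 / N]. *)
  have := dN _ _ ik; have := cell_dist N0 zj wj.
  have := dP _ _ _ _ z1 z2 w1 w2; rewrite /= -/(mix _ _) -/(mix _ _).
  move=> far near small; have := ler_wpM2l (ler0n R N) far.
  by move=> /(le_trans small) /le_lt_trans /(_ near); rewrite ltxx.
- move=> i; rewrite sum_fine; last by move=> j _; exact: fin_prod.
  have -> : fine (mu F1) * fine (mu F2) = fine ((mu \x mu)%E (F1 `*` F2)).
    by rewrite product_measure1E ?fineM ?fin_num_measure//; exact: mF.
  apply: fine_le; [exact: fin_prod|by apply/sum_fin_numP => j _ _; exact: fin_prod|].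
  apply: (measure_cover_le (mu \x mu : probability _ _)%E
    (c := fun j => mix (t i) @^-1` cell N j)) => //.
    by move=> k; exact: measurable_mix_cell.
  move=> [x y] [/= /F101 + /F201]; rewrite /= !in_itv/= => /andP[x0 x1] /andP[y0 y1].
  have /andP[t1 t2] := t14 i.
  by apply: cell_cover => //; rewrite /mix/=; apply/andP; split; nra.
- move=> i; apply: le_trans (HK (t i) N (t14 i) N0).
  rewrite ler_wpM2l//; apply: ler_sum => j _.
  rewrite ler_sqr ?nnegrE ?fine_ge0//; apply: fine_le; [exact: fin_prod|by apply: fin_prod; exact: measurable_mix_cell|].
  by apply: le_measure; rewrite ?inE//; [exact: measurable_mix_cell|move=> z []].
Qed.

(** * The coefficients and the nontrivial solution *)

Theorem theorem1 (R : realType) (E : set (measurableTypeR R))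
    (hE : measurable E) (hE01 : E `<=` `[0, 1])
    (hdim : 1 / 2 < fourier_dim E) :
  exists a b c d : nat,
    [/\ (0 < a)%N, (0 < b)%N, (0 < c)%N & (0 < d)%N] /\
    (a + b = c + d)%N /\
    exists x1 x2 y1 y2 : R,
      [/\ E x1, E x2, E y1 & E y2] /\
      is_solution a b c d x1 x2 y1 y2 /\
      ~ trivial_solution a b c d x1 x2 y1 y2.
Proof.
have [beta beta2 [mu [C [muE C0 dec]]]] := exists_decay_gt_half hdim.
have [K K0 HK] := cell_energy_bound C0 beta2 dec.
have [F1 [F2 [[cF1 cF2 F1E F2E] [F12 F1p F2p]]]] := disjoint_compacts hE hE01 muE HK.
have fine_pos (F : set R) : compact F -> (0 < mu F)%E -> 0 < fine (mu F).
  move=> cF Fp; rewrite fine_gt0// Fp/= -ge0_fin_numE// fin_num_measure//.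
  exact: compact_measurable.
set p := fine (mu F1) * fine (mu F2).
have p0 : 0 < p ^+ 2 by rewrite exprn_gt0// mulr_gt0// fine_pos.
pose M := (Num.truncn (2 * K / p ^+ 2)).+1.
have MK : 2 * K < M%:R * p ^+ 2 by rewrite -ltr_pdivrMr// truncnS_gt.
(* a > 2M > b, so that no a is a b. *)
pose a (i : 'I_M) := (2 * M + 1 + i)%N.
pose b (i : 'I_M) := (2 * M - 1 - i)%N.
(* As [i < M], the subtraction in [b i] is not truncated and [b i >= M]. *)
have ab i : (a i + b i = 4 * M)%N by rewrite /a /b; have := ltn_ord i; lia.
have M4 : 0 < (4 * M)%:R :> R by rewrite ltr0n.
pose t i : R := (a i)%:R / (4 * M)%:R.
have tb i : 1 - t i = (b i)%:R / (4 * M)%:R.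
  apply: (mulIf (lt0r_neq0 M4)); rewrite mulrBl !divfK ?lt0r_neq0// mul1r.
  by rewrite -{1}(ab i) natrD addrAC subrr add0r.
have t14 i : 1 / 4 <= t i <= 3 / 4.
  rewrite /t ler_pdivlMr// ler_pdivrMr//.
  have iM : (i.+1 <= M)%N := ltn_ord i.
  have : i%:R + 1 <= M%:R :> R by rewrite natr1 ler_nat.
  have : 0 <= i%:R :> R by [].
  by rewrite /a !natrD !natrM => i0 i1; apply/andP; split; lra.
have [i [k [x1 [x2 [y1 [y2 [ik [x1F x2F] [y1F y2F] eq]]]]]]] :=
  @mix_collision _ _ _ _ _ M t cF1 cF2 (subset_trans F1E hE01) (subset_trans F2E hE01) isT t14 MK HK.
exists (a i), (b i), (a k), (b k); split.
  by have := ltn_ord i; have := ltn_ord k; rewrite /a /b; split; lia.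
split; first by rewrite !ab.
exists x1, x2, y1, y2; split; first by split; [exact: F1E|exact: F2E|exact: F1E|exact: F2E].
split.
  rewrite /is_solution; move: eq; rewrite !tb /t ![_ / _ * _]mulrAC -!mulrDl.
  by move/(mulIf (invr_neq0 (lt0r_neq0 M4))).
(* Both genera are refuted without deciding which one holds: [x1 = x2] would lie in [F1] and [F2],
   [a i = a k] would give [i = k], and [a i = b k] contradicts [a i > 2 * M > b k]. *)
rewrite /trivial_solution; case: ifP => _ [].
- move=> x12 _ _; have : (F1 `&` F2) x1 by split=> //; rewrite x12.
  by rewrite F12.
- move=> [aik _ _ _]; move/eqP: ik; apply; apply: val_inj; move: aik; rewrite /a /=; lia.
- by move=> [aik _ _ _]; move: aik; rewrite /a /b; lia.
Qed.
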